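(* Let $f_1,\dots,f_n:\mathbb R^d\to\mathbb R$ be twice continuously differentiable, let each $f_i$ be $L_i$-smooth ($\|\nabla f_i(x)-\nabla f_i(y)\|\le L_i\|x-y\|$ for all $x,y$), and suppose there exist $D_i\ge0$ such that $$\sup_{z_1,\dots,z_n\in\mathbb R^d}\Big\|\nabla^2f_i(z_i)-\frac1n\sum_{j=1}^n\nabla^2f_j(z_j)\Big\|\le D_i\qquad\text{for all }i\in[n].$$ Then the Functional $(L_A,L_B)$ Inequality holds for $f_1,\dots,f_n$ with $$L_A=\sqrt2\max_{i\in[n]}D_i\le2\sqrt2\max_{i\in[n]}L_i\qquad\text{and}\qquad L_B=\sqrt2\left(\frac1n\sum_{i=1}^nL_i\right).$$
   Context: $[n]=\{1,\dots,n\}$; $\|\cdot\|$ is the Euclidean norm for vectors and the induced operator (spectral) norm for matrices. The Functional $(L_A,L_B)$ Inequality, for constants $L_A,L_B\ge0$, is: for all $x,u_1,\dots,u_n\in\mathbb R^d$, $$\Big\|\frac1n\sum_{i=1}^n(\nabla f_i(x+u_i)-\nabla f_i(x))\Big\|^2\le L_A^2\Big(\frac1n\sum_{i=1}^n\|u_i\|^2\Big)+L_B^2\Big\|\frac1n\sum_{i=1}^nu_i\Big\|^2.$$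
   Formalization: The bound √2 max D_i ≤ 2√2 max L_i fails for arbitrary admissible D_i (f_i = 0, L_i = 0, D_i = 1); it is stated for D_i equal to the suprema, shown finite, while the Functional Inequality is stated for all admissible D_i. *)

(* Defs.v *)
From HB Require Import structures.
From mathcomp Require Import all_boot all_order all_algebra.
From mathcomp Require Import all_classical all_reals all_analysis.

Set Implicit Arguments.
Unset Strict Implicit.
Unset Printing Implicit Defensive.
Import Order.TTheory GRing.Theory Num.Theory.
Import numFieldNormedType.Exports.
Local Open Scope classical_set_scope.
Local Open Scope ring_scope.

(* The norm [`|x|] that the library puts on ['rV[R]_d] is the sup norm. It
   induces the same topology, hence the same notions of differentiability and
   continuity, but every norm in the inequalities below must be Euclidean. *)
Definition enorm (R : realType) (d : nat) (v : 'rV[R]_d) : R :=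
  Num.sqrt (\sum_(k < d) v 0 k ^+ 2).

(* Vectors are rows, so matrices act on the right, as with ['J]. *)
Definition opnorm (R : realType) (d : nat) (A : 'M[R]_d) : R :=
  sup [set enorm (v *m A) | v in [set v : 'rV[R]_d | enorm v <= 1]].

Definition gradient (R : realType) (d : nat) (f : 'rV[R]_d -> R)
    (x : 'rV[R]_d) : 'rV[R]_d :=
  \row_(k < d) 'D_(delta_mx 0 k) f x.

Definition hessian (R : realType) (d : nat) (f : 'rV[R]_d -> R)
    (x : 'rV[R]_d) : 'M[R]_d :=
  'J (gradient f) x.

Definition twice_continuously_differentiable (R : realType) (d : nat)
    (f : 'rV[R]_d -> R) : Prop :=
  [/\ forall x, differentiable f x,
      forall x, differentiable (gradient f) x &
      continuous (hessian f)].

Definition smooth (R : realType) (d : nat) (L : R) (f : 'rV[R]_d -> R) : Prop :=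
  forall x y, enorm (gradient f x - gradient f y) <= L * enorm (x - y).

Definition mean (R : realType) (V : lmodType R) (n : nat) (u : 'I_n -> V) : V :=
  n%:R^-1 *: \sum_(i < n) u i.

(* The least admissible [D i], as an extended real because the supremum could
   be infinite. *)
Definition hessian_deviation (R : realType) (d n : nat)
    (f : 'I_n -> 'rV[R]_d -> R) (i : 'I_n) : \bar R :=
  ereal_sup [set (opnorm (hessian (f i) (z i)
                          - mean (fun j => hessian (f j) (z j))))%:E
            | z in [set: 'I_n -> 'rV[R]_d]].

Definition functional_inequality (R : realType) (d n : nat) (LA LB : R)
    (f : 'I_n -> 'rV[R]_d -> R) : Prop :=
  forall (x : 'rV[R]_d) (u : 'I_n -> 'rV[R]_d),
    enorm (mean (fun i => gradient (f i) (x + u i) - gradient (f i) x)) ^+ 2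
    <= LA ^+ 2 * (n%:R^-1 * \sum_(i < n) enorm (u i) ^+ 2)
       + LB ^+ 2 * enorm (mean u) ^+ 2.

(* The base value [0] is harmless for nonnegative constants, and [smooth L f]
   forces [0 <= L] as soon as [0 < d]. *)
Definition max_const (R : realType) (n : nat) (c : 'I_n -> R) : R :=
  \big[Num.max/0]_(i < n) c i.

(* Main.v *)
(* With H_i the Hessian of f_i and H the mean of the H_i, taken at arbitrary
   points z_i, split
     mean (u_i H_i) = mean (u_i (H_i - H)) + (mean u_i) H.
   The first term has norm at most max D * mean |u_i|, the second at most
   mean L * |mean u_i|; then use (a + b)^2 <= 2 a^2 + 2 b^2 and Jensen.
   Instead of integrating the Hessians along the segments [x, x + u_i], the mean
   value inequality for the single curve t |-> mean (grad f_i (x + t u_i))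
   bounds the increment by |mean (u_i H_i)| with all z_i = x + c u_i at a
   common time c. *)
Require Import Defs.
From mathcomp Require Import all_boot all_order all_algebra.
From mathcomp Require Import all_classical all_reals all_analysis.
From mathcomp Require Import ring lra.

Set Implicit Arguments.
Unset Strict Implicit.
Unset Printing Implicit Defensive.
Import Order.TTheory GRing.Theory Num.Theory.
Import numFieldNormedType.Exports.
Local Open Scope classical_set_scope.
Local Open Scope ring_scope.

(** * Euclidean inner product and norm on row vectors *)

Definition dot (R : realType) (d : nat) (u v : 'rV[R]_d) : R :=
  \sum_(k < d) u 0 k * v 0 k.

Lemma dotDl (R : realType) (d : nat) (u v w : 'rV[R]_d) :
  dot (u + v) w = dot u w + dot v w.
Proof.
by rewrite -big_split; apply: eq_bigr => k _; rewrite !mxE mulrDl.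
Qed.

Lemma dotC (R : realType) (d : nat) (u v : 'rV[R]_d) :
  dot u v = dot v u.
Proof. by apply: eq_bigr => k _; rewrite mulrC. Qed.

Lemma dotZl (R : realType) (d : nat) (a : R) (u v : 'rV[R]_d) :
  dot (a *: u) v = a * dot u v.
Proof. by rewrite mulr_sumr; apply: eq_bigr => k _; rewrite !mxE mulrA. Qed.

Lemma dotBl (R : realType) (d : nat) (u v w : 'rV[R]_d) :
  dot (u - v) w = dot u w - dot v w.
Proof. by rewrite -scaleN1r dotDl dotZl mulN1r. Qed.

Lemma enorm_ge0 (R : realType) (d : nat) (v : 'rV[R]_d) : 0 <= enorm v.
Proof. exact: sqrtr_ge0. Qed.

Lemma sqr_enorm (R : realType) (d : nat) (v : 'rV[R]_d) :
  enorm v ^+ 2 = dot v v.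
Proof. by rewrite sqr_sqrtr// sumr_ge0// => k _; rewrite sqr_ge0. Qed.

Lemma enorm0 (R : realType) (d : nat) : enorm (0 : 'rV[R]_d) = 0.
Proof.
rewrite /enorm big1 ?sqrtr0// => k _.
by rewrite mxE expr0n.
Qed.

Lemma enorm_eq0 (R : realType) (d : nat) (v : 'rV[R]_d) :
  enorm v = 0 -> v = 0.
Proof.
move=> v0; have /eqP : enorm v ^+ 2 = 0 by rewrite v0 expr0n.
rewrite sqr_enorm psumr_eq0 => [/allP v00|k _]; last by rewrite -expr2 sqr_ge0.
apply/rowP => k; rewrite mxE.
by have := v00 k (mem_index_enum k); rewrite /= mulf_eq0 orbb => /eqP.
Qed.

Lemma enormZ (R : realType) (d : nat) (a : R) (v : 'rV[R]_d) :
  enorm (a *: v) = `|a| * enorm v.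
Proof.
rewrite -sqrtr_sqr -sqrtrM ?sqr_ge0// mulr_sumr; congr Num.sqrt.
by apply: eq_bigr => k _; rewrite mxE exprMn.
Qed.

Lemma cauchy_schwarz (R : realType) (d : nat) (u v : 'rV[R]_d) :
  dot u v <= enorm u * enorm v.
Proof.
have [/enorm_eq0 ->|v0] := eqVneq (enorm v) 0.
  by rewrite enorm0 mulr0 /dot big1// => k _; rewrite mxE mulr0.
apply: (le_trans (ler_norm _)).
rewrite -(@ler_pXn2r _ 2)// ?nnegrE ?mulr_ge0 ?enorm_ge0// exprMn real_normK ?num_real//.
rewrite -subr_ge0 -(@pmulr_rge0 _ (enorm v ^+ 2)); last first.
  by rewrite exprn_gt0// lt_neqAle eq_sym v0 enorm_ge0.
(* The square below expands to [|v|^2 (|u|^2 |v|^2 - (u.v)^2)], which is why the goal was first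
   multiplied by [|v|^2 > 0]. *)
have := sqr_ge0 (enorm (dot v v *: u - dot u v *: v)).
rewrite !sqr_enorm; congr (_ <= _).
rewrite !(dotBl, dotZl) ![dot _ (_ - _)]dotC !(dotBl, dotZl) (dotC v u).
by ring.
Qed.

Lemma ler_enormD (R : realType) (d : nat) (u v : 'rV[R]_d) :
  enorm (u + v) <= enorm u + enorm v.
Proof.
rewrite -(@ler_pXn2r _ 2)// ?nnegrE ?addr_ge0 ?enorm_ge0//.
rewrite sqrrD !sqr_enorm dotDl ![dot _ (u + v)]dotC !dotDl (dotC v u).
by have := cauchy_schwarz u v; lra.
Qed.

Lemma ler_enorm_sum (R : realType) (d n : nat) (u : 'I_n -> 'rV[R]_d) :
  enorm (\sum_i u i) <= \sum_i enorm (u i).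
Proof.
apply: (big_ind2 (fun x y => enorm x <= y)) => [|x a y b xa yb|//].
  by rewrite enorm0.
by rewrite (le_trans (ler_enormD _ _))// lerD.
Qed.

Lemma ler_enormB (R : realType) (d : nat) (u v : 'rV[R]_d) :
  enorm (u - v) <= enorm u + enorm v.
Proof.
by rewrite (le_trans (ler_enormD _ _))// -scaleN1r enormZ normrN1 mul1r.
Qed.

Lemma ler_enorm_mean (R : realType) (d n : nat) (u : 'I_n -> 'rV[R]_d) :
  enorm (mean u) <= n%:R^-1 * \sum_i enorm (u i).
Proof.
rewrite enormZ ger0_norm ?invr_ge0 ?ler0n// ler_wpM2l ?invr_ge0 ?ler0n//.
exact: ler_enorm_sum.
Qed.

(** The topology on rows is that of the sup norm, so continuity goes through the coordinates. It
    lets Euclidean bounds pass to limits of difference quotients. *)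
Lemma enorm_continuous (R : realType) (d : nat) :
  continuous (@enorm R d : 'rV[R]_d -> R).
Proof.
move=> v; apply: (@continuous_comp _ _ _ (fun u : 'rV[R]_d =>
  \sum_(k < d) u 0 k ^+ 2) Num.sqrt); last exact: sqrt_continuous.
apply: continuous_big; first exact: add_continuous.
move=> k _ u; apply: (@continuous_comp _ _ _ (fun w : 'rV[R]_d => w 0 k)
    (fun r : R => r ^+ 2)).
  exact: coord_continuous.
exact: exprn_continuous.
Qed.

(** * Derivatives along curves and the mean value inequality *)

Lemma is_derive_dot (R : realType) (d : nat) (g : R -> 'rV[R]_d)
    (dg w : 'rV[R]_d) (t : R) :
  is_derive t 1 g dg -> is_derive t 1 (fun s => dot (g s) w) (dot dg w).
Proof.
move=> [gt <-].
rewrite (_ : (fun s => _) = \sum_(k < d) (w 0 k \*: (fun s => g s 0 k))); last first.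
  by apply/funext => s; rewrite fct_sumE; apply: eq_bigr => k _; rewrite mulrC.
rewrite (_ : dot _ w = \sum_(k < d) w 0 k *: 'D_1 (fun s => g s 0 k) t); last first.
  by rewrite derive_mx//; apply: eq_bigr => k _; rewrite mxE mulrC.
apply: is_derive_sum => k; apply: is_deriveZ; apply: derivableP.
by move/derivable_mxP: gt; apply.
Qed.

(* The scalar mean value theorem, applied to the component of [g] in the
   direction of its increment. *)
Lemma enorm_mean_value (R : realType) (d : nat) (g dg : R -> 'rV[R]_d)
    (a b : R) : a <= b ->
  (forall t : R, is_derive t 1 g (dg t)) ->
  exists c, enorm (g b - g a) <= enorm (dg c) * (b - a).
Proof.
move=> ab gP; set w := g b - g a.
have dP (t : R) : is_derive t 1 (fun s => dot (g s) w) (dot (dg t) w).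
  exact: is_derive_dot.
have [|c _] := @MVT_segment R (fun t => dot (g t) w) (fun t => dot (dg t) w) a b ab.
  apply: continuous_subspaceT => x.
  by apply/differentiable_continuous/derivable1_diffP; exact: ex_derive.
rewrite -dotBl -sqr_enorm => wE; exists c.
have [->|w0] := eqVneq (enorm w) 0.
  by rewrite mulr_ge0 ?enorm_ge0 ?subr_ge0.
rewrite -(@ler_pM2r _ (enorm w)) ?lt_neqAle 1?eq_sym ?w0 ?enorm_ge0//.
by rewrite -expr2 wE mulrAC ler_wpM2r ?subr_ge0// cauchy_schwarz.
Qed.

(** No chain rule is involved: the difference quotient of the curve at [t] is literally that of [F]
    at [x + t *: v] in direction [v]. *)
Lemma is_derive_line (R : realType) (V W : normedModType R) (F : V -> W)
    (x v : V) (t : R) :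
  derivable F (x + t *: v) v ->
  is_derive t 1 (fun s => F (x + s *: v)) ('D_v F (x + t *: v)).
Proof.
have E : (fun h => h^-1 *: (((fun s => F (x + s *: v)) \o shift t) (h *: 1)
    - F (x + t *: v)))
  = (fun h => h^-1 *: ((F \o shift (x + t *: v)) (h *: v) - F (x + t *: v))).
  by apply/funext => h /=; rewrite [h *: 1]mulr1 scalerDl addrCA.
by move=> Fx; split; rewrite /derivable /derive E.
Qed.

Lemma is_derive_gradient_line (R : realType) (d : nat) (f : 'rV[R]_d -> R)
    (x v : 'rV[R]_d) (t : R) :
  differentiable (gradient f) (x + t *: v) ->
  is_derive t 1 (fun s => gradient f (x + s *: v))
    (v *m hessian f (x + t *: v)).
Proof.
move=> fx; have <- := deriveEjacobian v fx.
by apply: is_derive_line; exact: diff_derivable.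
Qed.

(** The row [v *m hessian f x] is the limit of the difference quotients of the gradient in direction
    [v]; smoothness bounds each of them by [L * enorm v]. *)
Lemma enorm_mul_hessian (R : realType) (d : nat) (L : R) (f : 'rV[R]_d -> R)
    (x v : 'rV[R]_d) :
  differentiable (gradient f) x -> smooth L f ->
  enorm (v *m hessian f x) <= L * enorm v.
Proof.
move=> fx fL; rewrite -deriveEjacobian//.
have /cvg_ex[l gl] : derivable (gradient f) x v by exact: diff_derivable.
have -> : 'D_v (gradient f) x = l by exact: cvg_lim.
have : enorm (h^-1 *: ((gradient f \o shift x) (h *: v) - gradient f x))
    @[h --> 0^'] --> enorm l.
  by apply: (continuous_cvg _ _ gl); exact: enorm_continuous.
move/cvgr_to_le; apply; near=> h.
have h0 : h != 0 by near: h; exact: nbhs_dnbhs_neq.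
rewrite enormZ normfV ler_pdivrMl ?normr_gt0//.
by rewrite (le_trans (fL _ _))//= addrK enormZ mulrCA.
Unshelve. all: by end_near. Qed.

(** * The operator norm *)

Lemma le_opnorm_unit (R : realType) (d : nat) (C : R) (A : 'M[R]_d) :
  0 <= C -> (forall v, enorm (v *m A) <= C * enorm v) ->
  forall v, enorm v <= 1 -> enorm (v *m A) <= opnorm A.
Proof.
(* The a priori bound [C] only shows that the set is bounded above: on an unbounded set [sup] takes
   the default value 0 and bounds nothing. *)
move=> C0 AC v v1; apply: ub_le_sup; last by exists v.
by exists C => _ [w /= w1 <-]; rewrite (le_trans (AC _))// ler_piMr.
Qed.

Lemma opnorm_ge0 (R : realType) (d : nat) (C : R) (A : 'M[R]_d) :
  0 <= C -> (forall v, enorm (v *m A) <= C * enorm v) -> 0 <= opnorm A.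
Proof.
move=> C0 AC; have := le_opnorm_unit C0 AC (v := 0).
by rewrite mul0mx enorm0; apply.
Qed.

(** By homogeneity, the bound on the unit ball is applied to [v / |v|], once [v = 0] is set
    apart. *)
Lemma le_opnorm (R : realType) (d : nat) (C : R) (A : 'M[R]_d) :
  0 <= C -> (forall v, enorm (v *m A) <= C * enorm v) ->
  forall v, enorm (v *m A) <= opnorm A * enorm v.
Proof.
move=> C0 AC v; have [/enorm_eq0 ->|v0] := eqVneq (enorm v) 0.
  by rewrite mul0mx enorm0 mulr0.
have v_gt0 : 0 < enorm v by rewrite lt_neqAle eq_sym v0 enorm_ge0.
have nE : `|(enorm v)^-1| = (enorm v)^-1 by rewrite ger0_norm// invr_ge0 ltW.
rewrite -ler_pdivrMr// mulrC -[(enorm v)^-1]nE -enormZ scalemxAl.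
by apply: (le_opnorm_unit C0 AC); rewrite enormZ nE mulVf.
Qed.

Lemma opnorm_le (R : realType) (d : nat) (C : R) (A : 'M[R]_d) :
  0 <= C -> (forall v, enorm (v *m A) <= C * enorm v) -> opnorm A <= C.
Proof.
move=> C0 AC; apply: ge_sup.
  by exists (enorm (0 *m A)), 0; rewrite //= enorm0.
by move=> _ [w /= w1 <-]; rewrite (le_trans (AC _))// ler_piMr.
Qed.

(** * Maxima and averages of finite families *)

Lemma max_const_ge0 (R : realType) (n : nat) (c : 'I_n -> R) :
  0 <= max_const c.
Proof. by rewrite /max_const bigmax_idl le_max lexx. Qed.

Lemma le_max_const (R : realType) (n : nat) (c : 'I_n -> R) (i : 'I_n) :
  c i <= max_const c.
Proof. exact: le_bigmax. Qed.

Lemma mean_le_max_const (R : realType) (n : nat) (c : 'I_n -> R) :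
  (0 < n)%N -> n%:R^-1 * \sum_(i < n) c i <= max_const c.
Proof.
move=> n0; rewrite ler_pdivrMl ?ltr0n//.
rewrite (le_trans (ler_sum _ (fun i _ => le_max_const c i)))//.
by rewrite sumr_const card_ord mulr_natl.
Qed.

(** Jensen for the square, from the variance: with [m] the mean, the sum of [(x i - m)^2] equals the
    sum of [x i ^+ 2] minus [n m^2]. *)
Lemma sqr_mean_le (R : realType) (n : nat) (x : 'I_n -> R) :
  (0 < n)%N ->
  (n%:R^-1 * \sum_(i < n) x i) ^+ 2 <= n%:R^-1 * \sum_(i < n) x i ^+ 2.
Proof.
move=> n0; set m := n%:R^-1 * _.
have n1 : (n%:R : R) != 0 by rewrite pnatr_eq0 -lt0n.
have sE : \sum_(i < n) x i = n%:R * m by rewrite mulVKf.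
rewrite ler_pdivlMl ?ltr0n// -subr_ge0.
have : 0 <= \sum_(i < n) (x i - m) ^+ 2.
  by rewrite sumr_ge0// => i _; exact: sqr_ge0.
under eq_bigr do rewrite sqrrB -mulrnAr.
rewrite big_split /= sumrB -mulr_suml sE sumr_const card_ord.
congr (_ <= _); ring.
Qed.

(** * Averages of matrix actions *)

Lemma mulmx_mean (R : realType) (d n : nat) (v : 'rV[R]_d)
    (H : 'I_n -> 'M[R]_d) :
  v *m mean H = mean (fun i => v *m H i).
Proof. by rewrite -scalemxAr mulmx_sumr. Qed.

Lemma enorm_mulmx_mean (R : realType) (d n : nat) (c : 'I_n -> R)
    (H : 'I_n -> 'M[R]_d) :
  (forall i v, enorm (v *m H i) <= c i * enorm v) ->
  forall v, enorm (v *m mean H) <= n%:R^-1 * (\sum_(i < n) c i) * enorm v.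
Proof.
move=> Hc v; rewrite mulmx_mean (le_trans (ler_enorm_mean _))//.
by rewrite -mulrA ler_wpM2l ?invr_ge0 ?ler0n// mulr_suml ler_sum.
Qed.

(** Since [mean H] is the same for all [i], it factors out of the average of the [u i *m mean H]. *)
Lemma mean_mulmx_deviation (R : realType) (d n : nat) (u : 'I_n -> 'rV[R]_d)
    (H : 'I_n -> 'M[R]_d) :
  mean (fun i => u i *m H i) =
  mean (fun i => u i *m (H i - mean H)) + mean u *m mean H.
Proof.
rewrite -scalemxAl mulmx_suml -scalerDr -big_split /=; congr (_ *: _).
by apply: eq_bigr => i _; rewrite -mulmxDr subrK.
Qed.

Lemma enorm_mean_mulmx (R : realType) (d n : nat) (M : R) (L : 'I_n -> R)
    (u : 'I_n -> 'rV[R]_d) (H : 'I_n -> 'M[R]_d) :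
  (0 < n)%N ->
  (forall i v, enorm (v *m (H i - mean H)) <= M * enorm v) ->
  (forall i v, enorm (v *m H i) <= L i * enorm v) ->
  enorm (mean (fun i => u i *m H i)) ^+ 2 <=
  2 * (M ^+ 2 * (n%:R^-1 * \sum_(i < n) enorm (u i) ^+ 2)
    + (n%:R^-1 * \sum_(i < n) L i) ^+ 2 * enorm (mean u) ^+ 2).
Proof.
move=> n0 HM HL; rewrite mean_mulmx_deviation.
set a := M * (n%:R^-1 * \sum_(i < n) enorm (u i)).
set b := n%:R^-1 * (\sum_(i < n) L i) * enorm (mean u).
have aP : enorm (mean (fun i => u i *m (H i - mean H))) <= a.
  rewrite (le_trans (ler_enorm_mean _))// /a mulrCA.
  by rewrite ler_wpM2l ?invr_ge0 ?ler0n// mulr_sumr ler_sum.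
have bP : enorm (mean u *m mean H) <= b by exact: enorm_mulmx_mean.
have S := le_trans (ler_enormD _ _) (lerD aP bP).
(* Squaring needs [0 <= a + b], which [S] provides because a norm lies below it. *)
rewrite (@le_trans _ _ ((a + b) ^+ 2))//.
  by rewrite ler_pXn2r// nnegrE ?(le_trans _ S) ?enorm_ge0.
(* The gap between the two sides is [(a - b)^2]. This factor 2 is the source of [sqrt 2] in both
   constants. *)
rewrite (@le_trans _ _ (2 * (a ^+ 2 + b ^+ 2)))//.
  by have := sqr_ge0 (a - b); nra.
rewrite ler_pM2l ?ltr0n// lerD//; last by rewrite exprMn.
by rewrite exprMn ler_wpM2l ?sqr_ge0// sqr_mean_le.
Qed.

(** * Hessian deviations and the functional inequality *)

Lemma enorm_mul_deviation (R : realType) (d n : nat)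
    (f : 'I_n -> 'rV[R]_d -> R) (L : 'I_n -> R) (z : 'I_n -> 'rV[R]_d)
    (i : 'I_n) (v : 'rV[R]_d) :
  (forall i x, differentiable (gradient (f i)) x) ->
  (forall i, smooth (L i) (f i)) ->
  enorm (v *m (hessian (f i) (z i) - mean (fun j => hessian (f j) (z j))))
    <= 2 * max_const L * enorm v.
Proof.
move=> df fL; have Hle j w := enorm_mul_hessian w (df j (z j)) (fL j).
(* The factor 2 is the triangle inequality: one Hessian and the mean of all of them each contribute
   at most [max_const L]. *)
rewrite mulmxBr (le_trans (ler_enormB _ _))// mulr_natl mulr2n mulrDl lerD//.
  by rewrite (le_trans (Hle i v))// ler_wpM2r ?enorm_ge0// le_max_const.
rewrite (le_trans (enorm_mulmx_mean Hle v))// ler_wpM2r ?enorm_ge0//.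
by apply: mean_le_max_const; exact: leq_ltn_trans (ltn_ord i).
Qed.

(** Any [D] above the deviations is allowed, so that the result serves both for given constants and
    for the suprema themselves. *)
Lemma functional_inequality_deviation (R : realType) (d n : nat)
    (f : 'I_n -> 'rV[R]_d -> R) (L D : 'I_n -> R) :
  (0 < n)%N ->
  (forall i x, differentiable (gradient (f i)) x) ->
  (forall i, smooth (L i) (f i)) ->
  (forall i, (hessian_deviation f i <= (D i)%:E)%E) ->
  functional_inequality (Num.sqrt 2 * max_const D)
    (Num.sqrt 2 * (n%:R^-1 * \sum_(i < n) L i)) f.
Proof.
move=> n0 df fL fD x u.
pose g t := mean (fun i => gradient (f i) (x + t *: u i)).
pose H t i := hessian (f i) (x + t *: u i).
have fP i (t : R) : is_derive t 1
    (fun s => gradient (f i) (x + s *: u i)) (u i *m H t i).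
  exact: is_derive_gradient_line.
have gP (t : R) : is_derive t 1 g (mean (fun i => u i *m H t i)).
  rewrite (_ : g = n%:R^-1 \*: \sum_(i < n)
      (fun s => gradient (f i) (x + s *: u i))); last first.
    by apply/funext => s; rewrite /= fct_sumE.
  by apply: is_deriveZ; exact: is_derive_sum.
have [c] := enorm_mean_value ler01 gP; rewrite subr0 mulr1.
have -> : g 1 - g 0 = mean (fun i => gradient (f i) (x + u i) - gradient (f i) x).
  rewrite -scalerBr -sumrB; congr (_ *: _); apply: eq_bigr => i _.
  by rewrite scale1r scale0r addr0.
move=> gc; rewrite (@le_trans _ _ (enorm (mean (fun i => u i *m H c i)) ^+ 2))//.
  by rewrite ler_pXn2r// nnegrE enorm_ge0.
rewrite !(exprMn 2 (Num.sqrt 2)) (sqr_sqrtr (ler0n _ 2)).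
rewrite -2!(mulrA 2) -mulrDr.
apply: enorm_mean_mulmx => // [i v|i v]; last exact: enorm_mul_hessian.
(* Smoothness gives the a priori bound under which [opnorm] controls the matrix; [opnorm] is then
   compared with [D i] through the supremum, at the points [x + c *: u j]. *)
have Hle w := enorm_mul_deviation (fun j => x + c *: u j) i w df fL.
have M0 : 0 <= 2 * max_const L by rewrite mulr_ge0 ?ler0n ?max_const_ge0.
rewrite (le_trans (le_opnorm M0 Hle v))// ler_wpM2r ?enorm_ge0//.
rewrite (le_trans _ (le_max_const D i))// -lee_fin (le_trans _ (fD i))//.
by apply: ereal_sup_ubound; exists (fun j => x + c *: u j).
Qed.

(* An arbitrary admissible family [D] need not satisfy
   [max D <= 2 * max L] (any larger family is admissible too), so that bound is
   stated for the family [D'] of least admissible constants, the suprema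
   themselves, together with the functional inequality for it. *)
Theorem theorem4p8 (R : realType) (d n : nat) (hn : (0 < n)%N)
    (f : 'I_n -> 'rV[R]_d -> R) (L D : 'I_n -> R)
    (hC2 : forall i, twice_continuously_differentiable (f i))
    (hL : forall i, smooth (L i) (f i))
    (hD0 : forall i, 0 <= D i)
    (hD : forall i, (hessian_deviation f i <= (D i)%:E)%E) :
  functional_inequality (Num.sqrt 2 * max_const D)
    (Num.sqrt 2 * (n%:R^-1 * \sum_(i < n) L i)) f
  /\ exists D' : 'I_n -> R,
       [/\ forall i, hessian_deviation f i = (D' i)%:E,
           functional_inequality (Num.sqrt 2 * max_const D')
             (Num.sqrt 2 * (n%:R^-1 * \sum_(i < n) L i)) f &
           Num.sqrt 2 * max_const D' <= 2 * Num.sqrt 2 * max_const L].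
Proof.
have df i x : differentiable (gradient (f i)) x by have [] := hC2 i.
split; first exact: functional_inequality_deviation.
have M0 : 0 <= 2 * max_const L by rewrite mulr_ge0 ?ler0n ?max_const_ge0.
(* The suprema are real numbers because they lie between 0, by the value at [z = 0], and
   [2 * max_const L]. *)
have Dge0 i : (0 <= hessian_deviation f i)%E.
  rewrite (@le_trans _ _ (opnorm (hessian (f i) 0
      - mean (fun j => hessian (f j) 0)))%:E)//; last first.
    by apply: ereal_sup_ubound; exists (fun=> 0).
  rewrite lee_fin (opnorm_ge0 M0)// => v.
  exact: (enorm_mul_deviation (fun=> 0)).
have Dle i : (hessian_deviation f i <= (2 * max_const L)%:E)%E.
  apply: ge_ereal_sup => _ [z _ <-]; rewrite lee_fin opnorm_le// => v.
  exact: enorm_mul_deviation.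
have DE i : hessian_deviation f i = (fine (hessian_deviation f i))%:E.
  by rewrite fineK// ge0_fin_numE// (le_lt_trans (Dle i))// ltry.
exists (fun i => fine (hessian_deviation f i)); split => //.
  by apply: functional_inequality_deviation => // i; rewrite -DE.
rewrite mulrAC mulrC ler_wpM2r ?sqrtr_ge0//.
(* The base value 0 of the maximum is covered by [M0]. *)
by apply: bigmax_le => // i _; rewrite -lee_fin -DE.
Qed.
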